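(* Every pseudocyclic scheme of valency $k>1$ and rank at least $4(k-1)k^3$ is a Frobenius scheme and is separable.
   Context: A coherent configuration is a pair $(\Omega,S)$ with $\Omega$ finite and $S$ a partition of $\Omega\times\Omega$ such that the diagonal $1_\Omega$ is a union of elements of $S$, $S$ is closed under transposition, and for $r,s,t\in S$ the number $c_{rs}^t=|\{\beta:(\alpha,\beta)\in r,(\beta,\gamma)\in s\}|$ does not depend on $(\alpha,\gamma)\in t$. A scheme is one with $1_\Omega\in S$; rank $|S|$; $S^\#=S\setminus\{1_\Omega\}$; valency $n_s=|\{\beta:(\alpha,\beta)\in s\}|$. With $\mathcal P$ the set of central primitive idempotents of the adjacency algebra $\mathbb{C}S$, $n_P$ the dimension of an irreducible submodule of $\mathbb{C}^\Omega$ corresponding to $P$, $m_P=\operatorname{rk}(P)/n_P$ and $\mathcal P^\#=\mathcal P\setminus\{\frac1{|\Omega|}J\}$, the scheme is pseudocyclic if $m_P/n_P$ is constant on $\mathcal P^\#$; a pseudocyclic scheme has $n_s=k$ for all $s\in S^\#$ for some $k$, its valency. A Frobenius group is a non-regular transitive permutation group in which only the identity fixes two distinct points; a Frobenius scheme is the scheme (set of orbits on $\Omega\times\Omega$) of a Frobenius group. The scheme is separable if for every scheme $(\Omega',S')$ and every algebraic isomorphism $\varphi:S\to S'$ (bijection with $c_{\varphi(r)\varphi(s)}^{\varphi(t)}=c_{rs}^t$) there is a bijection $f:\Omega\to\Omega'$ with $f(s)=\varphi(s)$ for all $s\in S$. *)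

(* Defs.v *)
From HB Require Import structures.
From mathcomp Require Import all_boot all_order all_algebra all_fingroup all_field.
Set Implicit Arguments. Unset Strict Implicit. Unset Printing Implicit Defensive.
Import GRing.Theory Num.Theory.

Definition diag (T : finType) : {set T * T} := [set p | p.1 == p.2].

Definition transp (T : finType) (s : {set T * T}) : {set T * T} :=
  [set p | (p.2, p.1) \in s].

Definition inter_count (T : finType) (r s : {set T * T}) (a c : T) : nat :=
  #|[set b | ((a, b) \in r) && ((b, c) \in s)]|.

Definition coherent_configuration (T : finType) (S : {set {set T * T}}) : Prop :=
  [/\ partition S [set: T * T],
      (exists2 D : {set {set T * T}}, D \subset S & cover D = diag T),
      (forall s, s \in S -> transp s \in S) &
      (forall r s t, r \in S -> s \in S -> t \in S ->
         forall p q, p \in t -> q \in t ->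
           inter_count r s p.1 p.2 = inter_count r s q.1 q.2)].

Definition scheme (T : finType) (S : {set {set T * T}}) : Prop :=
  coherent_configuration S /\ diag T \in S.

Definition intersection_number (T : finType) (r s t : {set T * T}) : nat :=
  if [pick p in t] is Some p then inter_count r s p.1 p.2 else 0%N.

Definition valency_at (T : finType) (s : {set T * T}) (a : T) : nat :=
  #|[set b | (a, b) \in s]|.

Definition has_valency (T : finType) (S : {set {set T * T}}) (k : nat) : Prop :=
  forall s, s \in S -> s != diag T -> forall a, valency_at s a = k.

Local Open Scope ring_scope.

Definition adjm (T : finType) (s : {set T * T}) : 'M[algC]_#|T| :=
  \matrix_(i, j) (((enum_val i, enum_val j) \in s)%:R).

Definition adj_space (T : finType) (S : {set {set T * T}}) :=
  (\sum_(s in S) <<mxvec (adjm s)>>)%MS.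

Definition in_adj_alg (T : finType) (S : {set {set T * T}}) (M : 'M[algC]_#|T|) : bool :=
  (mxvec M <= adj_space S)%MS.

Definition central_idempotent (T : finType) (S : {set {set T * T}})
    (P : 'M[algC]_#|T|) : Prop :=
  [/\ in_adj_alg S P, P *m P = P &
      forall M, in_adj_alg S M -> P *m M = M *m P].

Definition central_primitive_idempotent (T : finType) (S : {set {set T * T}})
    (P : 'M[algC]_#|T|) : Prop :=
  [/\ central_idempotent S P, P != 0 &
      forall E, central_idempotent S E -> E *m P = E -> E = 0 \/ E = P].

Definition Jn (T : finType) : 'M[algC]_#|T| := (#|T|%:R)^-1 *: const_mx 1.

(* CS-submodules of C^T, as row spaces (CS acting by right multiplication) *)
Definition cs_invariant (T : finType) (S : {set {set T * T}}) (U : 'M[algC]_#|T|) : Prop :=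
  forall M, in_adj_alg S M -> (U *m M <= U)%MS.

(* U is an irreducible submodule of C^T corresponding to P
   (i.e. contained in the P-isotypic component, the row space of P) *)
Definition irreducible_submodule_of (T : finType) (S : {set {set T * T}})
    (P U : 'M[algC]_#|T|) : Prop :=
  [/\ U != 0, cs_invariant S U, (U <= P)%MS &
      forall V : 'M[algC]_#|T|, V != 0 -> (V <= U)%MS -> cs_invariant S V -> (U <= V)%MS].

(* pseudocyclic: m_P / n_P constant on P^#, with n_P = dim U for an irreducible
   submodule U corresponding to P, and m_P = rk(P) / n_P *)
Definition pseudocyclic (T : finType) (S : {set {set T * T}}) : Prop :=
  exists c : algC, forall P, central_primitive_idempotent S P -> P != Jn T ->
    forall U, irreducible_submodule_of S P U ->
      ((\rank P)%:R / (\rank U)%:R) / (\rank U)%:R = c.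

Definition frobenius_group (T : finType) (G : {group {perm T}}) : Prop :=
  [/\ (forall x y : T, exists2 g, g \in G & g x = y),
      ~ (forall (x : T) (g : {perm T}), g \in G -> g x = x -> g = 1%g) &
      (forall g, g \in G -> forall x y : T, x != y -> g x = x -> g y = y -> g = 1%g)].

Definition orbitals (T : finType) (G : {group {perm T}}) : {set {set T * T}} :=
  [set [set ((g : {perm T}) p.1, (g : {perm T}) p.2) | g in G] | p : T * T].

Definition frobenius_scheme (T : finType) (S : {set {set T * T}}) : Prop :=
  exists G : {group {perm T}}, frobenius_group G /\ S = orbitals G.

Definition image_rel (T T' : finType) (f : T -> T') (s : {set T * T}) : {set T' * T'} :=
  [set (f p.1, f p.2) | p in s].

Definition algebraic_isomorphism (T T' : finType) (S : {set {set T * T}})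
    (S' : {set {set T' * T'}}) (phi : {set T * T} -> {set T' * T'}) : Prop :=
  [/\ {in S &, injective phi}, phi @: S = S' &
      forall r s t, r \in S -> s \in S -> t \in S ->
        intersection_number (phi r) (phi s) (phi t) = intersection_number r s t].

Definition separable (T : finType) (S : {set {set T * T}}) : Prop :=
  forall (T' : finType) (S' : {set {set T' * T'}}) (phi : {set T * T} -> {set T' * T'}),
    scheme S' -> algebraic_isomorphism S S' phi ->
    exists f : T -> T', bijective f /\ forall s, s \in S -> image_rel f s = phi s.

(* Main.v *)
(** For points [x, y] write [col x y] for the relation of [S] containing [(x, y)].

Algebra.  Let [Z] be the sum over [s] of [A_s^T A_s / n_s]; it is central in the
adjacency algebra.  Schur orthogonality shows that on an irreducible submodule of
dimension [d] inside the isotypic component of [P] it acts as [n d^2 / rk P], so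
in a pseudocyclic scheme [Z] is a combination of [I] and [J].  Comparing the
diagonal and the column sums, any two distinct points [x, y] have exactly [k - 1]
points [z] with [col z x = col z y].

Combinatorics.  Given an algebraic isomorphism, points [a], [b] and images
[a'], [b'] with matching colours, choose for every [e] an image matching the
colours to [a] and [b].  By the count above, for fixed [a], [c], [d] all but at
most [k^2 (k - 1)] points [e] are such that the colours on the paths [c-a-d] and
[c-e-d] force the colour of [(c, d)].  Hence, for a suitable [b], the choices are
mutually consistent for most pairs of points, and since there are at least
[8 k^2 (k - 1)] points they can be corrected to a genuine isomorphism sending
[a] to [a'] and [b] to [b'].  This gives separability and, for the identity
algebraic isomorphism, enough automorphisms; the same count shows that a
nontrivial automorphism fixes at most one point. *)

From Stdlib Require Import Classical.
From mathcomp Require Import all_boot all_order all_algebra all_fingroup all_field.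
From mathcomp Require Import zify ring.
Require Import Defs.
Set Implicit Arguments. Unset Strict Implicit. Unset Printing Implicit Defensive.


(** * Union bounds, double counting and averaging over finite sets *)

Lemma leq_card_bigcup (I T : finType) (A : {set I}) (F : I -> {set T}) m :
  (forall i, i \in A -> #|F i| <= m) -> #|\bigcup_(i in A) F i| <= #|A| * m.
Proof.
move=> Fm; rewrite -sum_nat_const.
apply: (@leq_trans (\sum_(i in A) #|F i|)); last exact: leq_sum.
elim/big_rec2: _ => [|i n X _ leXn]; first by rewrite cards0.
by apply: leq_trans (leq_card_setU _ _) _; rewrite leq_add2l.
Qed.

Lemma double_count (I J : finType) (R : I -> J -> bool) :
  \sum_i #|[set j | R i j]| = \sum_j #|[set i | R i j]|.
Proof.
under eq_bigr do rewrite -sum1dep_card big_mkcond.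
under [RHS]eq_bigr do rewrite -sum1dep_card big_mkcond.
exact: exchange_big.
Qed.

Lemma exists_notin (T : finType) (A : {set T}) : #|A| < #|T| -> exists x, x \notin A.
Proof.
move=> ltA; apply/existsP; apply: contraLR ltA => /existsPn sA.
rewrite -leqNgt -cardsT; apply/subset_leq_card/subsetP => x _.
by have := sA x; rewrite negbK.
Qed.

Lemma sum_leq_exists (I : finType) (F : I -> nat) m :
  0 < #|I| -> \sum_i F i <= #|I| * m -> exists i, F i <= m.
Proof.
move=> I0 leF; apply/existsP; apply: contraTT leF => /existsPn gtF.
rewrite -ltnNge; apply: (@leq_trans (#|I| * m.+1)); first by rewrite mulnS; lia.
by rewrite -sum_nat_const; apply: leq_sum => i _; rewrite ltnNge.
Qed.

(** * Extending a partial colour isomorphism *)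

Section Misled.

Variables (T : finType) (C : eqType) (col : T -> T -> C) (k : nat).

Hypothesis val_le : forall x y, #|[set z | col x z == col x y]| <= k.
Hypothesis indist : forall x y, x != y -> #|[set z | col z x == col z y]| <= k.-1.

(* [~~ misled a c e d] says that [col c d] is the only colour lying both in
   [(c,a) o (a,d)] and in [(c,e) o (e,d)], a condition on intersection numbers
   only.  So a correspondence respecting the colours on the paths [c-a-d] and
   [c-e-d] must respect the colour of [(c,d)]. *)
Definition misled a c e d :=
  [exists d1, exists d2, [&& col a d1 == col a d, col e d2 == col e d,
    col c d2 == col c d1 & col c d1 != col c d]].

Let B := k * (k * k.-1).

(** There are at most [k] choices for the witness [d1], then at most [k] for [d2]. Since [col c d2]
    differs from [col c d], also [d2 != d], so at most [k - 1] points [e] fail to separate [d2] from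
    [d]. *)
Lemma card_misled a c d : #|[set e | misled a c e d]| <= B.
Proof.
pose F1 d1 := [set d2 | (col c d2 == col c d1) && (d2 != d)].
pose F2 d2 := [set e | col e d2 == col e d].
apply: (@leq_trans #|\bigcup_(d1 in [set z | col a z == col a d])
                     \bigcup_(d2 in F1 d1) F2 d2|).
  apply/subset_leq_card/subsetP => e; rewrite inE => /existsP[d1 /existsP[d2]].
  case/and4P=> a1 e2 c12 c1.
  apply/bigcupP; exists d1; rewrite ?inE //.
  apply/bigcupP; exists d2; rewrite !inE // c12; apply: contraNneq c1 => <-.
  by rewrite (eqP c12).
apply: leq_trans (leq_card_bigcup _) (leq_mul (val_le a d) (leqnn _)) => d1 _.
have card_F1 : #|F1 d1| <= k.
  apply: leq_trans (val_le c d1); apply/subset_leq_card/subsetP => z.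
  by rewrite !inE => /andP[].
apply: leq_trans (leq_card_bigcup _) (leq_mul card_F1 (leqnn _)) => d2.
by rewrite inE => /andP[_]; exact: indist.
Qed.

(** Averaging over [b]: each of the [#|T|^2] pairs is misled by at most [B] points. The factor 2
    pays for excluding [b = a], as [#|T| <= 2 * (#|T| - 1)]. *)
Lemma exists_rarely_misled a : 1 < #|T| ->
  exists2 b, b != a & #|[set p | misled a p.1 b p.2]| <= 2 * (#|T| * B).
Proof.
move=> T1; apply/exists_inP; apply: contraTT isT => /exists_inPn hb.
have h1 : \sum_b #|[set p | misled a p.1 b p.2]| <= #|T| * #|T| * B.
  rewrite (@double_count _ _ (fun b p => misled a p.1 b p.2)) -card_prod -sum_nat_const.
  by apply: leq_sum => p _; apply: card_misled.
have h2 : (#|T| - 1) * (2 * (#|T| * B)).+1 <= \sum_b #|[set p | misled a p.1 b p.2]|.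
  rewrite (bigD1 a) //=; apply: leq_trans (leq_addl _ _).
  rewrite subn1 -(cardC1 a) -(sum_nat_const (predC1 a)) [leqRHS](eq_bigl (mem (predC1 a))) //.
  by apply: leq_sum => b; rewrite inE => /hb; rewrite -ltnNge.
move: h1 h2 T1; move: (#|T|) B (\sum__ _) => n b s; nia.
Qed.

(** For [e] outside this set, [c] is determined by its colours from [a] and [e]. Each of at most [k]
    rivals [c1] spoils at most [k - 1] points [e]. *)
Lemma card_nontight a c :
  #|[set e | [exists c1, [&& c1 != c, col a c1 == col a c & col e c1 == col e c]]]|
    <= k * k.-1.
Proof.
pose F c1 := [set e | col e c1 == col e c].
pose A := [set z | (col a z == col a c) && (z != c)].
apply: (@leq_trans #|\bigcup_(c1 in A) F c1|).
  apply/subset_leq_card/subsetP => e; rewrite inE => /existsP[c1 /and3P[c1c ac ec]].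
  by apply/bigcupP; exists c1; rewrite !inE ?ac.
have cA : #|A| <= k.
  apply: leq_trans (val_le a c); apply/subset_leq_card/subsetP => z.
  by rewrite !inE => /andP[].
apply: leq_trans (leq_card_bigcup _) (leq_mul cA (leqnn _)) => d2.
by rewrite inE => /andP[_]; exact: indist.
Qed.

Variables (T' : finType) (C' : eqType) (col' : T' -> T' -> C') (phi : C -> C').

(** Stated for matched points rather than for a map, since images are chosen one by one before any
    map is known to preserve colours. *)
Definition compatible x x' y y' := col' x' y' = phi (col x y).

Hypothesis compatible_sym : forall x x' y y',
  compatible x x' y y' -> compatible y y' x x'.
Hypothesis phi_inj : forall x y z t, phi (col x y) = phi (col z t) -> col x y = col z t.
Hypothesis compatible_card : forall x x' y y' s t z w, compatible x x' y y' ->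
  s = col x z -> t = col y w ->
  #|[set v | (col x v == s) && (col y v == t)]| =
  #|[set v | (col' x' v == phi s) && (col' y' v == phi t)]|.
Hypothesis phi_onto : forall x' y', exists x y, col' x' y' = phi (col x y).
Hypothesis compatible_diag : forall x x' y', compatible x x' x y' <-> x' = y'.
Hypothesis col_onto : forall x y z, exists t, col x y = col z t.

Lemma compatible_lift x x' y y' z : compatible x x' y y' ->
  exists z', compatible x x' z z' /\ compatible y y' z z'.
Proof.
move=> cxy; have eq_card := compatible_card cxy (erefl (col x z)) (erefl (col y z)).
have : 0 < #|[set v | (col x v == col x z) && (col y v == col y z)]|.
  by apply/card_gt0P; exists z; rewrite inE !eqxx.
by rewrite eq_card => /card_gt0P[z']; rewrite inE => /andP[/eqP ? /eqP ?]; exists z'.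
Qed.

(** The converse of lifting: the colours of [z'] from [x'] and [y'] must first be realised as
    colours starting at [x] and [y] before the counts can be compared. *)
Lemma compatible_drop x x' y y' z' : compatible x x' y y' ->
  exists z, compatible x x' z z' /\ compatible y y' z z'.
Proof.
move=> cxy.
have [p [q pq]] := phi_onto x' z'; have [r [s rs]] := phi_onto y' z'.
have [z xz] := col_onto p q x; have [w yw] := col_onto r s y.
have eq_card := compatible_card cxy (xz) (yw).
have : 0 < #|[set v | (col' x' v == phi (col p q)) && (col' y' v == phi (col r s))]|.
  by apply/card_gt0P; exists z'; rewrite inE pq rs !eqxx.
rewrite -eq_card => /card_gt0P[v]; rewrite inE => /andP[/eqP xv /eqP yv].
by exists v; rewrite /compatible pq rs xv yv.
Qed.

(** Pull [d'] back to [d1] along [(a, c)] and to [d2] along [(e, c)]. If [col c d1] were not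
    [col c d], then [d1] and [d2] would witness that the path through [e] is misled. *)
Lemma compatible_trans a a' c c' e e' d d' : ~~ misled a c e d ->
  compatible a a' c c' -> compatible a a' d d' ->
  compatible c c' e e' -> compatible e e' d d' -> compatible c c' d d'.
Proof.
move=> nmis ac ad ce ed; have ec := compatible_sym ce.
have [d1 [ad1 cd1]] := compatible_drop d' ac.
have [d2 [ed2 cd2]] := compatible_drop d' ec.
rewrite /compatible cd1; congr phi; apply/eqP.
apply: contraNT nmis => cd; apply/existsP; exists d1; apply/existsP; exists d2.
rewrite cd andbT; apply/and3P; split; apply/eqP; apply: phi_inj.
- by rewrite -ad1 -ad.
- by rewrite -ed2 -ed.
- by rewrite -cd2 -cd1.
Qed.

(** Tightness says that exactly one point has the colours of [c] from [a] and [e]; preservation of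
    the count gives the same uniqueness in [T']. *)
Lemma compatible_tight a a' e e' c c1 c2 :
    ~~ [exists c1, [&& c1 != c, col a c1 == col a c & col e c1 == col e c]] ->
    compatible a a' e e' ->
    compatible a a' c c1 -> compatible a a' c c2 ->
    compatible e e' c c1 -> compatible e e' c c2 ->
  c1 = c2.
Proof.
move=> tight ae ac1 ac2 ec1 ec2.
have := compatible_card ae (erefl (col a c)) (erefl (col e c)).
have -> : [set v | (col a v == col a c) && (col e v == col e c)] = [set c].
  apply/setP=> v; rewrite !inE; apply/idP/eqP=> [/andP[av ev]|->]; last by rewrite !eqxx.
  apply/eqP; apply: contraNT tight => vc; apply/existsP; exists v.
  by rewrite vc av.
rewrite cards1 => /esym/eqP/cards1P[v /setP eqv].
have := eqv c1; rewrite !inE ac1 ec1 !eqxx => /esym/eqP->.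
by have := eqv c2; rewrite !inE ac2 ec2 !eqxx => /esym/eqP->.
Qed.

Hypothesis large : 8 * B <= #|T|.
Hypothesis k_gt1 : 1 < k.

Let Bpos : 0 < B. Proof. by rewrite /B; nia. Qed.

(* A colour-compatible choice [g] of images relative to [(a, a')] and
   [(b, b')] may be wrong at many points, but it respects the colours of all
   but few pairs; the true isomorphism [f] is obtained from it by majority vote. *)
Lemma extend_pair a a' b b' :
    #|[set p | misled a p.1 b p.2]| <= 2 * (#|T| * B) -> compatible a a' b b' ->
  exists f : T -> T', [/\ forall x y, compatible x (f x) y (f y), f a = a' & f b = b'].
Proof.
move=> rarely ab.
have T0 : 0 < #|T| by lia.
have /fin_all_exists[g /all_and2[ag bg]] :
    forall e, exists e', compatible a a' e e' /\ compatible b b' e e'.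
  by move=> e; apply: compatible_lift.
pose wrong e1 e2 := col' (g e1) (g e2) != phi (col e1 e2).
have wrong_misled e1 e2 : wrong e1 e2 -> misled a e1 b e2.
  apply: contraNT => nmis; apply/eqP.
  exact: compatible_trans nmis (ag _) (ag _) (compatible_sym (bg _)) (bg _).
have sum_wrong : \sum_e #|[set e2 | wrong e e2]| <= 2 * (#|T| * B).
  apply: leq_trans rarely.
  under eq_bigr do rewrite -sum1dep_card.
  rewrite pair_big_dep /= sum1dep_card.
  apply/subset_leq_card/subsetP => -[e1 e2]; rewrite !inE /=; exact: wrong_misled.
have /fin_all_exists[f /all_and2[af fg]] : forall c, exists c', compatible a a' c c' /\
    #|[set e | col' c' (g e) != phi (col c e)]| <= 3 * B.
  move=> c.
  (* On average over [e1], the first term is at most [2 * B] and the second at most [B]. Lifting [c]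
     along [(a, e1)] gives an image that can clash with [g e2] only at points [e2] counted here. *)
  have [|e1 le1] := @sum_leq_exists _
      (fun e1 => #|[set e2 | wrong e1 e2]| + #|[set e2 | misled a c e1 e2]|) (3 * B) T0.
    rewrite big_split /= (@double_count _ _ (fun e1 e2 => misled a c e1 e2)).
    have le2 : \sum_e #|[set e1 | misled a c e1 e]| <= #|T| * B.
      by rewrite -sum_nat_const; apply: leq_sum => e _; apply: card_misled.
    have -> : 3 * B = 2 * B + B by lia.
    by rewrite mulnDr mulnCA leq_add.
  have [c' [ac ec]] := compatible_lift c (ag e1).
  exists c'; split=> //; apply: leq_trans le1.
  apply: leq_trans (leq_card_setU _ _); apply/subset_leq_card/subsetP => e2.
  rewrite !inE; apply: contraR; rewrite negb_or negbK => /andP[/eqP e12 nmis].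
  apply/eqP; exact: compatible_trans nmis ac (ag _) (compatible_sym ec) e12.
have ff c d : compatible c (f c) d (f d).
  (* The three bad sets have at most [3 * B], [3 * B] and [B] points, in total less than [8 * B]; a
     point [e] outside them carries the colour from [c] to [d]. *)
  have /exists_notin[e] : #|[set e | col' (f c) (g e) != phi (col c e)] :|:
      [set e | col' (f d) (g e) != phi (col d e)] :|: [set e | misled a c e d]| < #|T|.
    apply: leq_ltn_trans (leq_card_setU _ _) _.
    have := leq_add (leq_card_setU [set e | col' (f c) (g e) != phi (col c e)]
        [set e | col' (f d) (g e) != phi (col d e)]) (card_misled a c d).
    have := fg c; have := fg d; have := large; have := Bpos; lia.
  rewrite !inE !negb_or => /andP[/andP[/negPn/eqP ce /negPn/eqP de] nmis].
  have ed : compatible e (g e) d (f d) by apply: compatible_sym.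
  exact: compatible_trans nmis (af _) (af _) ce ed.
exists f; split=> //; first exact/esym/compatible_diag/af.
(* Both [f b] and [b'] match [b] as seen from [a] and from any good [e]; they coincide once [e] is
   also tight. At most [3 * B + k * k.-1 <= 4 * B] points are excluded. *)
have /exists_notin[e] : #|[set e | col' (f b) (g e) != phi (col b e)] :|:
    [set e | [exists c1, [&& c1 != b, col a c1 == col a b & col e c1 == col e b]]]| < #|T|.
  apply: leq_ltn_trans (leq_card_setU _ _) _.
  have := fg b; have := card_nontight a b.
  have : k * k.-1 <= B by rewrite /B; nia.
  lia.
rewrite !inE !negb_or => /andP[/negPn/eqP be tight].
have eb : compatible e (g e) b (f b) by apply: compatible_sym.
exact: compatible_tight tight (ag e) (af b) ab eb (compatible_sym (bg e)).
Qed.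

End Misled.

(** * Colours of a scheme *)

Definition color (T : finType) (S : {set {set T * T}}) (x y : T) : {set T * T} :=
  pblock S (x, y).

Section Scheme.

Variables (T : finType) (S : {set {set T * T}}).
Hypothesis schS : scheme S.

Lemma color_in x y : color S x y \in S.
Proof.
have [[partS _ _ _] _] := schS.
by apply: pblock_mem; rewrite (cover_partition partS) inE.
Qed.

Lemma color_eq s x y : s \in S -> (color S x y == s) = ((x, y) \in s).
Proof.
have [[partS _ _ _] _] := schS => sS.
apply/eqP/idP=> [<-|xys]; first by rewrite mem_pblock (cover_partition partS) inE.
by apply: def_pblock sS xys; case/and3P: partS.
Qed.

Lemma color_exists s : s \in S -> exists x y, color S x y = s.
Proof.
have [[/and3P[_ _ S0] _ _ _] _] := schS => sS.
have /set0Pn[[x y] xys] : s != set0 by apply: contraNneq S0 => <-.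
by exists x, y; apply/eqP; rewrite color_eq.
Qed.

Lemma transp_in s : s \in S -> transp s \in S.
Proof. by have [[_ _ + _] _] := schS => /[apply]. Qed.

Lemma color_transp x y : color S y x = transp (color S x y).
Proof.
apply/eqP; rewrite color_eq ?transp_in ?color_in // inE /= -color_eq ?color_in //.
Qed.

Lemma color_diag x y : (color S x y == diag T) = (x == y).
Proof. by have [_ dS] := schS; rewrite color_eq // inE. Qed.

Lemma color_refl x : color S x x = diag T.
Proof. by apply/eqP; rewrite color_diag. Qed.

(** The definition evaluates at an arbitrary picked pair; coherence makes the value independent of
    that pair. *)
Lemma intersection_numberE r s x y : r \in S -> s \in S ->
  intersection_number r s (color S x y) =
  #|[set z | (color S x z == r) && (color S z y == s)]|.
Proof.
have [[_ _ _ homS] _] := schS => rS sS.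
have -> : [set z | (color S x z == r) && (color S z y == s)] =
    [set z | ((x, z) \in r) && ((z, y) \in s)].
  by apply/setP=> z; rewrite !inE !color_eq.
have xyS : (x, y) \in color S x y by rewrite -color_eq ?color_in.
rewrite /intersection_number; case: pickP => [p pS|/(_ (x, y))]; last by rewrite xyS.
exact: homS rS sS (color_in x y) _ (x, y) pS xyS.
Qed.

Lemma transp_invol : involutive (@transp T).
Proof. by move=> s; apply/setP => -[x y]; rewrite !inE. Qed.

Lemma color_card x y s t : s \in S -> t \in S ->
  #|[set z | (color S x z == s) && (color S y z == t)]| =
  intersection_number s (transp t) (color S x y).
Proof.
move=> sS tS; rewrite intersection_numberE ?transp_in //; apply: eq_card => z.
by rewrite !inE (color_transp y z) (inj_eq (can_inj transp_invol)).
Qed.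

Lemma intersection_gt0P x y r s : r \in S -> s \in S ->
  reflect (exists z, color S x z = r /\ color S z y = s)
          (0 < intersection_number r s (color S x y)).
Proof.
move=> rS sS; rewrite intersection_numberE //; apply: (iffP card_gt0P) => -[z].
  by rewrite inE => /andP[/eqP ? /eqP ?]; exists z.
by case=> xz zy; exists z; rewrite inE xz zy !eqxx.
Qed.

Lemma color_onto k : has_valency S k -> 0 < k ->
  forall x y z, exists t, color S x y = color S z t.
Proof.
move=> valS k0 x y z; have xyS := color_in x y.
have [->|xyD] := eqVneq (color S x y) (diag T); first by exists z; rewrite color_refl.
have : 0 < valency_at (color S x y) z by rewrite valS.
by case/card_gt0P => t; rewrite inE -color_eq // => /eqP; exists t.
Qed.

Lemma card_color_le k : has_valency S k -> 0 < k ->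
  forall x y, #|[set z | color S x z == color S x y]| <= k.
Proof.
move=> valS k0 x y; have xyS := color_in x y.
have [->|xyD] := eqVneq (color S x y) (diag T).
  rewrite (@eq_card1 _ x) // => z.
  by rewrite !inE color_diag eq_sym.
rewrite -(valS _ xyS xyD x); apply/eq_leq/eq_card => z.
by rewrite !inE color_eq.
Qed.

Lemma card_scheme_le k (a : T) : has_valency S k -> 0 < k -> #|S| <= #|T|.
Proof.
move=> valS k0; apply: leq_trans (leq_imset_card (color S a) T).
apply/subset_leq_card/subsetP => s /color_exists[x [y <-]].
by have [t ->] := color_onto valS k0 x y a; apply: imset_f.
Qed.

End Scheme.

(** * Algebraic isomorphisms of schemes *)

Section AlgebraicIsomorphism.

Variables (T T' : finType) (S : {set {set T * T}}) (S' : {set {set T' * T'}}).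
Variable phi : {set T * T} -> {set T' * T'}.
Hypotheses (schS : scheme S) (schS' : scheme S').
Hypothesis isoP : algebraic_isomorphism S S' phi.

Lemma iso_in s : s \in S -> phi s \in S'.
Proof. by have [_ <- _] := isoP => sS; apply: imset_f. Qed.

Lemma iso_onto x' y' : exists x y, color S' x' y' = phi (color S x y).
Proof.
have [_ im _] := isoP; have := color_in schS' x' y'; rewrite -im => /imsetP[s sS ->].
by have [x [y <-]] := color_exists schS sS; exists x, y.
Qed.

Lemma iso_inj x y z t :
  phi (color S x y) = phi (color S z t) -> color S x y = color S z t.
Proof. by have [inj _ _] := isoP; apply: inj; apply: color_in. Qed.

(** Let [d0] be the preimage of the diagonal of [T']. Multiplying [phi (diag T)] by [phi d0] gives
    [phi (diag T)] back; pulled to [S], the product of [diag T] and [d0] meets [diag T], so [d0] is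
    [diag T]. *)
Lemma iso_diag : phi (diag T) = diag T'.
Proof.
have [inj im num] := isoP; have [_ dS] := schS; have [_ dS'] := schS'.
have [d0 d0S d0E] : exists2 d0, d0 \in S & phi d0 = diag T'.
  by move: dS'; rewrite -im => /imsetP[d0]; exists d0.
have [x' [y' xy']] := color_exists schS' (iso_in dS).
have : 0 < intersection_number (phi (diag T)) (phi d0) (phi (diag T)).
  rewrite -{2}xy'; apply/(intersection_gt0P schS'); rewrite ?iso_in //.
  by exists y'; rewrite color_refl.
have [x [y xy]] := color_exists schS dS.
rewrite num // -{2}xy => /(intersection_gt0P schS _ _ dS d0S)[z [/eqP]].
rewrite color_diag // => /eqP<-; rewrite xy => d0D.
by rewrite -d0E d0D.
Qed.

(** The transpose of [s] is the only relation whose product with [s] meets the diagonal, and [phi]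
    preserves this property. *)
Lemma iso_transp s : s \in S -> phi (transp s) = transp (phi s).
Proof.
move=> sS; have [inj im num] := isoP; have [_ dS] := schS.
have [x [y xy]] := color_exists schS sS.
have : 0 < intersection_number (phi s) (phi (transp s)) (phi (diag T)).
  rewrite num ?transp_in // -(color_refl schS x).
  apply/(intersection_gt0P schS); rewrite ?transp_in //; exists y.
  by rewrite (color_transp schS x y) xy.
have [x' [y' xy']] := color_exists schS' (iso_in dS).
rewrite -xy' => /(intersection_gt0P schS')[]; rewrite ?iso_in ?transp_in // => z' [xz zy].
have /eqP: color S' x' y' = diag T' by rewrite xy' iso_diag.
rewrite color_diag // => /eqP eq_xy; move: zy; rewrite -eq_xy => <-.
by rewrite (color_transp schS' x' z') xz.
Qed.

Lemma iso_sym x x' y y' : compatible (color S) (color S') phi x x' y y' ->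
  compatible (color S) (color S') phi y y' x x'.
Proof.
rewrite /compatible (color_transp schS x y) (color_transp schS' x' y') => ->.
by rewrite iso_transp ?color_in.
Qed.

Lemma iso_refl x x' y' : compatible (color S) (color S') phi x x' x y' <-> x' = y'.
Proof.
rewrite /compatible color_refl // iso_diag; split=> [/eqP|->]; last exact: color_refl.
by rewrite color_diag // => /eqP.
Qed.

Lemma iso_card x x' y y' s t : compatible (color S) (color S') phi x x' y y' ->
  s \in S -> t \in S ->
  #|[set v | (color S x v == s) && (color S y v == t)]| =
  #|[set v | (color S' x' v == phi s) && (color S' y' v == phi t)]|.
Proof.
move=> xy sS tS; have [_ _ num] := isoP.
rewrite (color_card schS) // (color_card schS') ?iso_in //.
by rewrite xy -iso_transp // num ?transp_in ?color_in.
Qed.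

Lemma iso_card_eq : #|T'| <= #|T|.
Proof.
case: (pickP T') => [a' _|/eq_card0->] //.
have [a [b _]] := iso_onto a' a'; have [inj im _] := isoP.
have aa : compatible (color S) (color S') phi a a' a a' by apply/iso_refl.
(* The number of points is the sum of the valencies. The repeated condition puts a valency in the
   form of [iso_card] with [x = y] and [s = t]. *)
have card_part (U : finType) (R : {set {set U * U}}) (u : U) : scheme R ->
    #|U| = \sum_(s in R) #|[set z | (color R u z == s) && (color R u z == s)]|.
  move=> schR; rewrite -sum1_card (partition_big (color R u) (mem R)) => [|z _]; last first.
    exact: color_in.
  by apply: eq_bigr => s _; rewrite -sum1dep_card; apply: eq_bigl => z; rewrite andbb.
rewrite (card_part _ S' a') // (card_part _ S a) //.
rewrite (eq_bigl (mem (phi @: S))) => [|s]; last by rewrite im.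
rewrite big_imset //=.
by apply/eq_leq/esym/eq_bigr => s sS; apply: iso_card.
Qed.

(** Such a map is injective because the diagonal is preserved and reflected, hence bijective by
    comparing cardinalities. *)
Lemma iso_separates (f : T -> T') :
  (forall x y, compatible (color S) (color S') phi x (f x) y (f y)) ->
  bijective f /\ forall s, s \in S -> image_rel f s = phi s.
Proof.
move=> ff; have injf : injective f.
  move=> x y eqf; have := ff x y; rewrite /compatible eqf color_refl // -iso_diag.
  rewrite -(color_refl schS x) => /iso_inj/esym; rewrite color_refl // => /eqP.
  by rewrite color_diag // => /eqP.
have bijf := inj_card_bij injf iso_card_eq; split=> // s sS.
have fE x y : ((f x, f y) \in phi s) = ((x, y) \in s).
  rewrite -(color_eq schS') ?iso_in // -(color_eq schS) // ff; apply/eqP/eqP=> [|-> //].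
  have [z [w <-]] := color_exists schS sS; exact: iso_inj.
apply/setP => -[x' y']; apply/imsetP/idP => [[[x y] xys [-> ->]]|]; first by rewrite fE.
case: bijf => g _ gK; rewrite -(gK x') -(gK y') fE => xys.
by exists (g x', g y').
Qed.

End AlgebraicIsomorphism.

(** * Automorphisms of a scheme of large rank *)

Section Extension.

Variables (T : finType) (S : {set {set T * T}}) (k : nat).
Hypotheses (schS : scheme S) (valS : has_valency S k) (k_gt1 : 1 < k).
Hypothesis indist :
  forall x y, x != y -> #|[set z | color S z x == color S z y]| <= k.-1.
Hypothesis large : 4 * (k - 1) * k ^ 3 <= #|S|.

Let k_gt0 : 0 < k := ltnW k_gt1.

(** There are at least as many points as colours, and [4 * (k - 1) * k ^ 3] exceeds the required
    bound by the factor [k / 2 >= 1]. *)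
Lemma large_points (a : T) : 8 * (k * (k * k.-1)) <= #|T|.
Proof.
apply: leq_trans (card_scheme_le schS a valS k_gt0); apply: leq_trans large.
have -> : 8 * (k * (k * k.-1)) = 4 * (k - 1) * (k * (k * 2)) by rewrite -subn1; nia.
by rewrite !expnS expn0 muln1 !leq_mul.
Qed.

(** The point [b] is fixed before [S'], [phi] and the images, since being rarely misled concerns [S]
    alone; this uniformity is what yields many automorphisms. *)
Lemma extension (a : T) : exists2 b, b != a &
  forall (T' : finType) (S' : {set {set T' * T'}}) (phi : {set T * T} -> {set T' * T'}),
    scheme S' -> algebraic_isomorphism S S' phi ->
  forall a' b', compatible (color S) (color S') phi a a' b b' ->
  exists f : T -> T', [/\
    forall x y, compatible (color S) (color S') phi x (f x) y (f y), f a = a' & f b = b'].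
Proof.
have largeT := large_points a.
have [|b ba rarely] := exists_rarely_misled (card_color_le schS valS k_gt0) indist a.
  have : 0 < k * (k * k.-1) by rewrite !muln_gt0; lia.
  by lia.
exists b => // T' S' phi schS' isoP a' b'; apply: extend_pair rarely => //.
- exact: card_color_le.
- exact: iso_sym.
- exact: iso_inj schS isoP.
- by move=> x x' y y' s t z w xy -> ->; apply: iso_card; rewrite ?color_in.
- exact: iso_onto.
- exact: iso_refl.
- exact: color_onto valS k_gt0.
Qed.

Lemma scheme_card_gt0 : 0 < #|T|.
Proof.
have : 0 < #|S| by apply: leq_trans large; rewrite !muln_gt0 subn_gt0 k_gt1 k_gt0.
by case/card_gt0P => s /(color_exists schS)[a _]; apply/card_gt0P; exists a.
Qed.

Lemma scheme_separable : separable S.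
Proof.
move=> T' S' phi schS' isoP; have /card_gt0P[a _] := scheme_card_gt0.
have [b _ ext] := extension a.
have [a' [b' [_ ab]]] : exists a' b',
    compatible (color S) (color S') phi a a' a a' /\ compatible (color S) (color S') phi a a' b b'.
  have [_ dS'] := schS'; have [a' _] := color_exists schS' dS'; exists a'.
  have aa : compatible (color S) (color S') phi a a' a a' by apply/iso_refl.
  have [|b' [_ ab]] := compatible_lift _ b aa; last by exists b'.
  by move=> x x' y y' s t z w xy -> ->; apply: iso_card; rewrite ?color_in.
have [f [ff _ _]] := ext T' S' phi schS' isoP a' b' ab.
by exists f; exact: (iso_separates schS schS' isoP ff).
Qed.

(** * The automorphism group and the Frobenius property *)

Definition color_aut : {set {perm T}} :=
  [set g : {perm T} | [forall x, forall y, color S (g x) (g y) == color S x y]].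

Lemma color_autP (g : {perm T}) :
  reflect (forall x y, color S (g x) (g y) = color S x y) (g \in color_aut).
Proof.
rewrite inE; apply: (iffP forallP) => gP x; first by move=> y; have /forallP/(_ y)/eqP := gP x.
by apply/forallP => y; rewrite gP.
Qed.

Lemma color_aut_group_set : group_set color_aut.
Proof.
apply/group_setP; split=> [|g h /color_autP gP /color_autP hP]; apply/color_autP => x y.
  by rewrite !perm1.
by rewrite !permM hP gP.
Qed.
Canonical color_aut_group := Group color_aut_group_set.

(** Extension applied to the identity algebraic isomorphism of [S]. *)
Lemma color_aut_transitive a a' : exists2 b, b != a & forall b',
  color S a' b' = color S a b -> exists2 g, g \in color_aut & g a = a' /\ g b = b'.
Proof.
have [b ba ext] := extension a; exists b => // b' ab.
have id_iso : algebraic_isomorphism S S id.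
  by split=> //; rewrite imset_id.
have [f [ff fa fb]] := ext T S id schS id_iso a' b' ab.
have [bijf _] := iso_separates schS schS id_iso ff.
exists (perm (bij_inj bijf)); last by rewrite !permE.
by apply/color_autP => x y; rewrite !permE ff.
Qed.

Lemma card_color x y : x != y -> #|[set z | color S x z == color S x y]| = k.
Proof.
move=> xy; rewrite -(valS (color_in schS x y) _ x) ?color_diag //.
by apply: eq_card => z; rewrite !inE color_eq ?color_in.
Qed.

(* Counting the triangles on a fixed vertex [x] with prescribed colours in two
   ways: as all valencies are equal, [c] is not determined by [x] and [y]
   exactly when [y] is not determined by [x] and [c]. *)
Lemma nontight_sym x y c c1 : x != y -> c1 != c ->
    color S x c1 = color S x c -> color S y c1 = color S y c ->
  exists y1, [/\ y1 != y, color S x y1 = color S x y & color S c y1 = color S c y].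
Proof.
move=> xy c1c xc1 yc1.
have xc : x != c.
  apply: contraNneq c1c => xc; move: xc1; rewrite -xc color_refl // => /eqP.
  by rewrite color_diag // eq_sym.
pose Y := [set y2 | color S x y2 == color S x y].
pose X := [set c2 | color S x c2 == color S x c].
pose N1 := #|[set c2 | (color S x c2 == color S x c) && (color S y c2 == color S y c)]|.
pose N2 := #|[set y2 | (color S x y2 == color S x y) && (color S c y2 == color S c y)]|.
have N1_ge2 : 1 < N1.
  apply/card_gt1P; exists c, c1; rewrite !inE xc1 yc1 !eqxx; split=> //.
  by rewrite eq_sym.
have eqN : k * N1 = k * N2.
  rewrite -[in LHS](card_color xy) -[in RHS](card_color xc) -!sum_nat_const.
  transitivity (\sum_(y2 in Y) #|[set c2 | (color S x c2 == color S x c)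
                                       && (color S y2 c2 == color S y c)]|).
    apply: eq_bigr => y2; rewrite inE => /eqP xy2.
    by rewrite /N1 !color_card ?color_in // xy2.
  transitivity (\sum_(c2 in X) #|[set y2 | (color S x y2 == color S x y)
                                       && (color S c2 y2 == color S c y)]|); last first.
    apply: eq_bigr => c2; rewrite inE => /eqP xc2.
    by rewrite /N2 !color_card ?color_in // xc2.
  pose R y2 c2 := [&& y2 \in Y, c2 \in X & color S y2 c2 == color S y c].
  transitivity (\sum_y2 #|[set c2 | R y2 c2]|).
    rewrite big_mkcond; apply: eq_bigr => y2 _; rewrite /R.
    case: ifP => y2Y; first by apply: eq_card => c2; rewrite !inE.
    by rewrite (eq_card0 (A := [set _ | _])) // => c2; rewrite !inE.
  rewrite double_count [RHS]big_mkcond; apply: eq_bigr => c2 _; rewrite /R.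
  case: ifP => c2X; last first.
    by rewrite (eq_card0 (A := [set _ | _])) // => y2; rewrite !inE andbF.
  apply: eq_card => y2; rewrite !inE /=; congr andb.
  rewrite (color_transp schS y2 c2) (color_transp schS y c).
  by rewrite (inj_eq (can_inj (@transp_invol _))).
have {eqN} eqN : N1 = N2 by apply/eqP; rewrite -(eqn_pmul2l k_gt0) eqN.
have : 0 < #|[set y2 | (color S x y2 == color S x y) && (color S c y2 == color S c y)] :\ y|.
  move: N1_ge2; rewrite eqN /N2 (cardsD1 y) inE !eqxx; lia.
case/card_gt0P => y1; rewrite !inE => /and3P[? /eqP ? /eqP ?]; by exists y1.
Qed.

(** If [g] moves [z0], its fixed points cannot separate [z0] from [g z0], so there are at most
    [k - 1]. A moved point [c] is not determined by its colours from [x] and [y], so by symmetry [y]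
    is not determined from [x] and [c]; there are at most [k * (k - 1)] such [c]. This is too few
    points in all. *)
Lemma color_aut_semiregular (g : {perm T}) x y :
  g \in color_aut -> x != y -> g x = x -> g y = y -> g = 1%g.
Proof.
move=> /color_autP gP xy gx gy; apply/permP => z0; rewrite perm1; apply/eqP/negPn/negP => gz0.
have /card_gt0P[a _] := scheme_card_gt0.
have fixed_le : #|[set z | g z == z]| <= k.-1.
  apply: leq_trans (indist gz0); apply/subset_leq_card/subsetP => z.
  by rewrite !inE => /eqP gz; rewrite -{1}gz gP.
have moved_le : #|[set z | g z != z]| <= k * k.-1.
  apply: leq_trans (card_nontight (card_color_le schS valS k_gt0) indist x y).
  apply/subset_leq_card/subsetP => c; rewrite !inE => gc.
  have xgc : color S x (g c) = color S x c by rewrite -{1}gx gP.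
  have ygc : color S y (g c) = color S y c by rewrite -{1}gy gP.
  have [y1 [y1y xy1 cy1]] := nontight_sym xy gc xgc ygc.
  by apply/existsP; exists y1; rewrite y1y xy1 cy1 !eqxx.
have cardT : #|T| = #|[set z | g z == z]| + #|[set z | g z != z]|.
  rewrite -(cardsC [set z | g z == z]); congr (_ + _).
  by apply: eq_card => z; rewrite !inE.
have := large_points a; rewrite cardT.
have : k * k.-1 <= k * (k * k.-1) by rewrite leq_pmull.
have : k.-1 <= k * k.-1 by rewrite leq_pmull.
have : 0 < k * (k * k.-1) by rewrite !muln_gt0; lia.
lia.
Qed.

Lemma color_aut_fix_inj a y (g h : {perm T}) : y != a ->
    g \in color_aut -> h \in color_aut -> g a = a -> h a = a -> g y = h y ->
  g = h.
Proof.
move=> ya gP hP ga ha gh.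
have ghP : (g * h^-1)%g \in color_aut_group by rewrite groupM ?groupV.
apply/eqP; rewrite eq_mulgV1; apply/eqP/(color_aut_semiregular ghP ya).
  by rewrite permM gh permK.
by rewrite permM ga -{1}ha permK.
Qed.

(** The stabilizer [H] of [a] acts freely on the other points, so all its orbits there have size
    [#|H|]. For the special point [b] the orbit is the whole colour class, so [#|H|] is at least
    [k], and every orbit fills its class. *)
Lemma color_aut_schurian a y z : color S a z = color S a y ->
  exists2 g, g \in color_aut & g a = a /\ g y = z.
Proof.
have [<- /eqP|ya azy] := eqVneq a y.
  rewrite color_refl // color_diag // => /eqP <-; exists 1%g; last by rewrite perm1.
  exact: (group1 color_aut_group).
have [b ba mv] := color_aut_transitive a a.
pose H := [set g in color_aut | (g : {perm T}) a == a].
pose orb x := [set (g : {perm T}) x | g in H].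
have inj_H x : x != a -> {in H &, injective (fun g : {perm T} => g x)}.
  move=> xa g h; move=> /setIdP[gP /eqP ga] /setIdP[hP /eqP ha].
  exact: color_aut_fix_inj xa gP hP ga ha.
have card_orb x : x != a -> #|orb x| = #|H| by move=> xa; rewrite card_in_imset //; exact: inj_H.
have sub_orb x : orb x \subset [set z | color S a z == color S a x].
  apply/subsetP => _ /imsetP[g /setIdP[/color_autP gP /eqP ga] ->].
  by rewrite inE -{1}ga gP.
have k_le : k <= #|H|.
  rewrite -(card_orb b ba) -(card_color (x := a) (y := b)) 1?eq_sym //.
  apply/subset_leq_card/subsetP => b'; rewrite inE => /eqP /mv[g gP [ga gb]].
  by apply/imsetP; exists g => //; apply/setIdP; rewrite ga.
have : orb y == [set z | color S a z == color S a y].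
  by rewrite eqEcard sub_orb card_color // card_orb // eq_sym.
move/eqP/setP/(_ z); rewrite inE azy eqxx => /imsetP[g].
by case/setIdP => gP /eqP ga zE; exists g.
Qed.

Lemma color_aut_point a a' : exists2 g, g \in color_aut & g a = a'.
Proof.
have [b _ mv] := color_aut_transitive a a'.
have [b' ab] := color_onto schS valS k_gt0 a b a'.
by have [g gP [ga _]] := mv b' (esym ab); exists g.
Qed.

Lemma scheme_frobenius : frobenius_scheme S.
Proof.
exists color_aut_group; split; first split.
- exact: color_aut_point.
(* The [k > 1] points of the colour class of [b] are all reached from [b] by automorphisms fixing
   [a], so the stabilizer is not trivial. *)
- move=> regular; have /card_gt0P[a _] := scheme_card_gt0.
  have [b ba mv] := color_aut_transitive a a.
  have : 1 < #|[set z | color S a z == color S a b]| by rewrite card_color // eq_sym.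
  case/card_gt1P => b1 [b2 []]; rewrite !inE => /eqP /mv[g gP [ga gb]] /eqP /mv[h hP [ha hb]].
  by rewrite -gb -hb (regular a g) // (regular a h) // eqxx.
- by move=> g gP x y; apply: color_aut_semiregular gP.
have orbitE p s : s \in S -> p \in s ->
    [set ((g : {perm T}) p.1, (g : {perm T}) p.2) | g in color_aut] = s.
  case: p => x y sS; rewrite -(color_eq schS) // => /eqP xy; apply/setP => -[x' y'].
  rewrite -(color_eq schS x' y' sS); apply/imsetP/eqP => [[g /color_autP gP [-> ->]]|xy'].
    by rewrite gP.
  (* Move [x] to [x'] first, then correct the second point inside the stabilizer of [x']. *)
  have [g gP gx] := color_aut_point x x'.
  have [h hP [hx hy]] : exists2 h, h \in color_aut & h x' = x' /\ h (g y) = y'.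
    by apply: color_aut_schurian; rewrite xy' -xy -gx; move/color_autP: gP => ->.
  by exists (g * h)%g; rewrite /= ?permM ?gx ?hx ?hy // (groupM (G := color_aut_group)).
apply/setP => s; apply/idP/imsetP => [sS | [[x y] _ ->]].
  have [x [y xy]] := color_exists schS sS; exists (x, y) => //.
  by rewrite (orbitE _ s) // -(color_eq schS) // xy.
by rewrite (orbitE _ (color S x y)) ?color_in // -(color_eq schS) ?color_in //.
Qed.

End Extension.

(** * The adjacency algebra *)

Import GRing.Theory Num.Theory.

(** * Hermitian adjoints, orthogonal complements and traces *)

Section Hermitian.

Local Open Scope ring_scope.

Definition adjoint m n (A : 'M[algC]_(m, n)) : 'M[algC]_(n, m) := map_mx Num.conj A^T.

Lemma adjointM m n p (A : 'M_(m, n)) (B : 'M_(n, p)) :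
  adjoint (A *m B) = adjoint B *m adjoint A.
Proof. by rewrite /adjoint trmx_mul map_mxM. Qed.

Lemma adjointK m n (A : 'M_(m, n)) : adjoint (adjoint A) = A.
Proof. by apply/matrixP => i j; rewrite !mxE conjCK. Qed.

Lemma mxtrace_adjoint m n (A : 'M_(m, n)) :
  \tr (A *m adjoint A) = \sum_i \sum_j `|A i j| ^+ 2.
Proof.
by apply: eq_bigr => i _; rewrite mxE; apply: eq_bigr => j _; rewrite !mxE normCK.
Qed.

Lemma mxtrace_adjoint_ge0 m n (A : 'M_(m, n)) : 0 <= \tr (A *m adjoint A).
Proof.
by rewrite mxtrace_adjoint; do 2!apply: sumr_ge0 => ? _; rewrite exprn_ge0.
Qed.

Lemma mxtrace_adjoint_eq0 m n (A : 'M_(m, n)) : \tr (A *m adjoint A) = 0 -> A = 0.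
Proof.
rewrite mxtrace_adjoint => /psumr_eq0P A0; apply/matrixP => i j; rewrite mxE.
have /psumr_eq0P/(_ j isT) : \sum_j `|A i j| ^+ 2 = 0.
  by apply: A0 => // l _; apply: sumr_ge0 => ? _; rewrite exprn_ge0.
move=> Aij; apply/eqP; rewrite -normr_eq0 -(sqrf_eq0 `|A i j|) Aij // => l _.
by rewrite exprn_ge0.
Qed.

Definition orthomx m n (U : 'M[algC]_(m, n)) : 'M_n := kermx (adjoint U).

Lemma orthomx_cap n (U : 'M_n) : (U :&: orthomx U)%MS = 0.
Proof.
set W := (U :&: _)%MS.
have /submxP[D WE] : (W <= U)%MS by apply: capmxSl.
have /sub_kermxP W0 : (W <= orthomx U)%MS by apply: capmxSr.
by apply: mxtrace_adjoint_eq0; rewrite {2}WE adjointM mulmxA W0 mul0mx mxtrace0.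
Qed.

Lemma orthomx_add n (U : 'M_n) : (1%:M <= U + orthomx U)%MS.
Proof.
rewrite sub1mx -col_leq_rank -[leqRHS]addn0 -(mxrank0 algC n n) -(orthomx_cap U).
by rewrite mxrank_sum_cap mxrank_ker mxrank_map mxrank_tr subnKC // rank_leq_row.
Qed.

(** In a full-rank factorization of [P], idempotency forces the product of the factors in reverse
    order to be the identity of size [\rank P]. *)
Lemma mxtrace_idempotent n (P : 'M[algC]_n) : P *m P = P -> \tr P = (\rank P)%:R.
Proof.
move=> PP; rewrite -{1}(mulmx_base P) mxtrace_mulC.
suff -> : row_base P *m col_base P = 1%:M by rewrite mxtrace1.
have CRCR : col_base P *m (row_base P *m col_base P) *m row_base P = P.
  by rewrite mulmxA -(mulmxA (_ *m _)) mulmx_base PP.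
apply: (row_full_inj (col_base_full P)); apply: (row_free_inj (row_base_free P)).
by rewrite /= CRCR mulmx1 mulmx_base.
Qed.

End Hermitian.

(** * Submodules of the standard module and Schur's lemma *)

Section AdjacencyAlgebra.

Local Open Scope ring_scope.

Variables (T : finType) (S : {set {set T * T}}) (k : nat).
Hypotheses (schS : scheme S) (valS : has_valency S k) (k_gt0 : (0 < k)%N).

Let n := #|T|.
Let cl (i j : 'I_n) := color S (enum_val i) (enum_val j).
(** With the identity as [P], containment in its row space is automatic, so this is plain
    irreducibility. *)
Let irreducible := irreducible_submodule_of S 1%:M.

Lemma adjmE s i j : s \in S -> adjm s i j = (cl i j == s)%:R.
Proof. by move=> sS; rewrite mxE /cl color_eq. Qed.

Lemma adj_algP (M : 'M_n) :
  in_adj_alg S M <-> (forall i j i' j', cl i j = cl i' j' -> M i j = M i' j').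
Proof.
split=> [algM i j i' j' eq_cl | clM].
  (* [K] encodes the linear functional sending [M] to [M i j - M i' j']; it vanishes on every
     generator [adjm s], hence on the algebra. *)
  pose K : 'cV[algC]_(n * n) := delta_mx (mxvec_index i j) 0 - delta_mx (mxvec_index i' j') 0.
  have KE A : (mxvec A *m K) 0 0 = A i j - A i' j'.
    by rewrite mulmxBr -!colE !mxE !mxvecE.
  have : (mxvec M <= kermx K)%MS.
    apply: submx_trans algM _; apply/sumsmx_subP => s sS; rewrite genmxE.
    apply/sub_kermxP/matrixP => a b; rewrite !ord1 KE.
    by rewrite !(adjmE _ _ sS) eq_cl subrr mxE.
  by move/sub_kermxP/matrixP/(_ 0 0); rewrite KE mxE => /eqP; rewrite subr_eq0 => /eqP.
pose m s := if [pick p | cl p.1 p.2 == s] is Some p then M p.1 p.2 else 0.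
have -> : M = \sum_(s in S) m s *: adjm s.
  apply/matrixP => i j; rewrite summxE.
  have clS : cl i j \in S by apply: color_in.
  rewrite (bigD1 (cl i j)) //= big1 => [|s /andP[sS sij]]; last first.
    by rewrite mxE adjmE // eq_sym (negPf sij) mulr0.
  rewrite addr0 mxE adjmE // eqxx mulr1 /m.
  by case: pickP => [p /eqP/esym/clM//|/(_ (i, j))]; rewrite eqxx.
rewrite /in_adj_alg linear_sum; apply: summx_sub => s sS.
by rewrite linearZ scalemx_sub // (sumsmx_sup s) // genmxE.
Qed.

Lemma adj_alg_expand M : in_adj_alg S M -> exists m, forall i j, M i j = m (cl i j).
Proof.
move/adj_algP => clM.
exists (fun s => if [pick p | cl p.1 p.2 == s] is Some p then M p.1 p.2 else 0) => i j.
by case: pickP => [p /eqP/esym/clM//|/(_ (i, j))]; rewrite eqxx.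
Qed.

Lemma card_enum_val (A : {set T}) (B : {set 'I_n}) :
  (forall i, (i \in B) = (enum_val i \in A)) -> #|B| = #|A|.
Proof.
move=> BA; rewrite -(card_imset B enum_val_inj); apply: eq_card => x.
apply/imsetP/idP => [[i iB ->]|xA]; first by rewrite -BA.
by exists (enum_rank x); rewrite ?BA enum_rankK.
Qed.

(** Grouping the inner index by its colours from [i] and to [j] expresses each entry of the product
    through intersection numbers. *)
Lemma adj_algM M N : in_adj_alg S M -> in_adj_alg S N -> in_adj_alg S (M *m N).
Proof.
move=> /adj_alg_expand[m mE] /adj_alg_expand[p pE]; apply/adj_algP => i j i' j' eq_cl.
rewrite !mxE; under eq_bigr do rewrite mE pE.
under [RHS]eq_bigr do rewrite mE pE.
have S2 x y z : (cl x z, cl z y) \in setX S S by rewrite inE /= !color_in.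
rewrite (partition_big (fun z => (cl i z, cl z j)) (mem (setX S S))) //=.
rewrite [RHS](partition_big (fun z => (cl i' z, cl z j')) (mem (setX S S))) //=.
apply: eq_bigr => -[r s]; rewrite inE /= => /andP[rS sS].
have cardE x y : \sum_(z | (cl x z, cl z y) == (r, s)) m (cl x z) * p (cl z y) =
    m r * p s *+ intersection_number r s (cl x y).
  transitivity (\sum_(z in [set z | (cl x z == r) && (cl z y == s)]) m r * p s).
    apply: eq_big => z; first by rewrite inE.
    by case/eqP => -> ->.
  rewrite sumr_const intersection_numberE //; congr (_ *+ _).
  by apply: card_enum_val => z; rewrite !inE.
by rewrite !cardE eq_cl.
Qed.

Lemma adj_alg_adjm s : s \in S -> in_adj_alg S (adjm s).
Proof. by move=> sS; apply/adj_algP => i j i' j' eq_cl; rewrite !adjmE // eq_cl. Qed.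

Lemma cl_tr i j i' j' : cl i j = cl i' j' -> cl j i = cl j' i'.
Proof. by rewrite /cl => eq_cl; rewrite color_transp // eq_cl -color_transp. Qed.

Lemma adj_alg_tr M : in_adj_alg S M -> in_adj_alg S M^T.
Proof. by move/adj_algP => clM; apply/adj_algP => i j i' j' /cl_tr/clM; rewrite !mxE. Qed.

Lemma adj_alg_adjoint M : in_adj_alg S M -> in_adj_alg S (adjoint M).
Proof. by move/adj_algP => clM; apply/adj_algP => i j i' j' /cl_tr/clM; rewrite !mxE => ->. Qed.

Lemma adj_alg_sum (I : finType) (B : pred I) (F : I -> 'M_n) :
  (forall i, B i -> in_adj_alg S (F i)) -> in_adj_alg S (\sum_(i | B i) F i).
Proof. by move=> algF; rewrite /in_adj_alg linear_sum summx_sub. Qed.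

Lemma adj_algZ a M : in_adj_alg S M -> in_adj_alg S (a *: M).
Proof. by rewrite /in_adj_alg linearZ; apply: scalemx_sub. Qed.

Lemma adj_alg_const a : in_adj_alg S (const_mx a).
Proof. by apply/adj_algP => i j i' j' _; rewrite !mxE. Qed.

Lemma cl_diag i j : (cl i j == diag T) = (i == j).
Proof. by rewrite color_diag // (inj_eq enum_val_inj). Qed.

Lemma adjm_diag : adjm (diag T) = 1%:M.
Proof.
by have [_ dS] := schS; apply/matrixP => i j; rewrite adjmE // cl_diag !mxE.
Qed.

Lemma cs_invariant_orthomx (U : 'M_n) : cs_invariant S U -> cs_invariant S (orthomx U).
Proof.
move=> invU M algM; apply/sub_kermxP; rewrite -mulmxA.
have /submxP[D UD] := invU _ (adj_alg_adjoint algM).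
have -> : M *m adjoint U = adjoint U *m adjoint D.
  by rewrite -{1}(adjointK M) -adjointM UD adjointM.
by rewrite mulmxA mulmx_ker mul0mx.
Qed.

Lemma cs_invariant_cap (U V : 'M_n) :
  cs_invariant S U -> cs_invariant S V -> cs_invariant S (U :&: V)%MS.
Proof.
move=> invU invV M algM; rewrite sub_capmx.
by rewrite (submx_trans (submxMr _ (capmxSl _ _)) (invU _ algM))
  (submx_trans (submxMr _ (capmxSr _ _)) (invV _ algM)).
Qed.

Lemma exists_irreducible (V : 'M_n) : V != 0 -> cs_invariant S V ->
  exists2 U, irreducible U & (U <= V)%MS.
Proof.
elim: {V}_.+1 {-2}V (ltnSn (\rank V)) => // r IH V ltVr V0 invV.
have [irrV | redV] := classic (irreducible V); first by exists V.
have [W [W0 WV invW VW]] : exists W : 'M_n,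
    [/\ W != 0, (W <= V)%MS, cs_invariant S W & ~~ (V <= W)%MS].
  apply: NNPP => noW; apply: redV; split=> [||| W W0 WV invW]; rewrite ?submx1 //.
  by apply/negP => /negP VW; apply: noW; exists W.
have [|U irrU UW] := IH W _ W0 invW; last by exists U; rewrite // (submx_trans UW).
by rewrite -ltnS (leq_trans _ ltVr) // ltnS rank_ltmx // ltmxE WV.
Qed.

(* Complete reducibility: the orthogonal complement of a submodule is one. *)
Lemma irreducible_ext (M : 'M_n) : (forall W, irreducible W -> W *m M = 0) -> M = 0.
Proof.
move=> M0; suff inv0 V : cs_invariant S V -> V *m M = 0.
  by rewrite -[M]mul1mx inv0 // => N _; rewrite submx1.
elim: {V}_.+1 {-2}V (ltnSn (\rank V)) => // r IH V ltVr invV.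
have [-> | V0] := eqVneq V 0; first by rewrite mul0mx.
have [W irrW WV] := exists_irreducible V0 invV; have [W0 invW _ _] := irrW.
have sVW : (V <= W + (orthomx W :&: V))%MS.
  rewrite (matrix_modl _ WV) sub_capmx submx_refl andbT.
  exact: submx_trans (submx1 _) (orthomx_add _).
have /sub_kermxP WM : W *m M = 0 by apply: M0.
have /sub_kermxP VM : (orthomx W :&: V)%MS *m M = 0.
  apply: IH; last exact: cs_invariant_cap (cs_invariant_orthomx invW) invV.
  apply: (@leq_trans (\rank V)) => //; rewrite rank_ltmx // ltmxE capmxSr.
  apply: contraNN W0 => VW; rewrite -submx0 -(orthomx_cap W) sub_capmx submx_refl.
  by rewrite (submx_trans WV) // (submx_trans VW) // capmxSl.
by apply/sub_kermxP; rewrite (submx_trans sVW) // addsmx_sub WM.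
Qed.

Definition commutant (M : 'M_n) := forall N, in_adj_alg S N -> N *m M = M *m N.

(** Schur's lemma: [M] has an eigenvalue on [U] since the field is algebraically closed, and the
    eigenspace in [U] is a nonzero submodule. *)
Lemma irreducible_scalar U M : irreducible U -> commutant M -> (U *m M <= U)%MS ->
  exists a, U *m M = a *: U.
Proof.
move=> [U0 invU _ minU] comM UM; pose u := row_base U.
have uM : (u *m M <= u)%MS by rewrite !(eqmxMr _ (eq_row_base U)) eq_row_base.
have [|a] := eigenvalue_closed (u *m M *m pinvmx u); first by rewrite lt0n mxrank_eq0.
case/eigenvalueP => v vE v0; exists a.
pose V := (U :&: kermx (M - a%:M))%MS.
have vuM : v *m u *m M = a *: (v *m u).
  by rewrite -mulmxA -(mulmxKpV uM) [v *m _]mulmxA vE scalemxAl.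
have vu0 : v *m u != 0.
  apply: contraNneq v0 => vu; apply/eqP/(row_free_inj (row_base_free U)).
  by rewrite /= vu mul0mx.
have vuV : (v *m u <= V)%MS.
  rewrite sub_capmx (submx_trans (submxMl _ _)) ?eq_row_base //.
  by apply/sub_kermxP; rewrite mulmxBr vuM mul_mx_scalar subrr.
have V0 : V != 0 by apply: contraNneq vu0 => V0; rewrite -submx0 -V0.
have : (U <= V)%MS.
  apply: minU; rewrite ?capmxSl // => N algN; rewrite sub_capmx.
  rewrite (submx_trans (submxMr _ (capmxSl _ _)) (invU _ algN)) /=.
  apply/sub_kermxP; rewrite -mulmxA mulmxBr comM // scalar_mxC -mulmxBl mulmxA.
  by have /sub_kermxP-> := capmxSr U (kermx (M - a%:M)); rewrite mul0mx.
rewrite sub_capmx => /andP[_ /sub_kermxP].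
by rewrite mulmxBr mul_mx_scalar => /eqP; rewrite subr_eq0 => /eqP.
Qed.

(** * The averaging operator and the central element [Z] *)

Let nv (s : {set T * T}) : nat := if s == diag T then 1%N else k.

Lemma card_cl x i j : #|[set z | cl x z == cl i j]| = nv (cl i j).
Proof.
rewrite (card_enum_val (A := [set z | (enum_val x, z) \in cl i j])) => [|z]; last first.
  by rewrite !inE -(color_eq schS) ?color_in.
rewrite /nv; have [->|clD] := eqVneq (cl i j) (diag T); last first.
  by rewrite -(valS _ clD (enum_val x)) ?color_in.
rewrite (@eq_card1 _ (enum_val x)) // => z.
by rewrite !inE eq_sym.
Qed.

Lemma nv_neq0 s : (nv s)%:R != 0 :> algC.
Proof. by rewrite pnatr_eq0 -lt0n /nv; case: ifP. Qed.

(** After clearing valencies, both sides are the sum of [M x' z] over [x'] with [cl p x' = cl p x]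
    and [z] with [cl p z = cl q y]: in each order, the inner sum is an entry of a product in the
    algebra and depends only on a colour. *)
Lemma adjm_mul_entries M p x q y : in_adj_alg S M ->
  (nv (cl q y))%:R^-1 * (M *m (adjm (cl q y))^T) x p =
  (nv (cl p x))%:R^-1 * (adjm (cl p x) *m M) q y.
Proof.
move=> algM; set s := cl q y; set t := cl p x.
have [sS tS] : s \in S /\ t \in S by rewrite !color_in.
suff eqLR : (nv t)%:R * (M *m (adjm s)^T) x p = (nv s)%:R * (adjm t *m M) q y.
  rewrite -[X in _ * X = _](mulKf (nv_neq0 t)) eqLR mulrCA; congr (_ * _).
  by rewrite mulKf ?nv_neq0.
have LE x' : (M *m (adjm s)^T) x' p = \sum_(z | cl p z == s) M x' z.
  rewrite mxE [RHS]big_mkcond; apply: eq_bigr => z _; rewrite mxE adjmE //.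
  by case: ifP; rewrite ?mulr1 ?mulr0.
have RE q' z : (adjm t *m M) q' z = \sum_(x' | cl q' x' == t) M x' z.
  rewrite mxE [RHS]big_mkcond; apply: eq_bigr => x' _; rewrite adjmE //.
  by case: ifP; rewrite ?mul1r ?mul0r.
transitivity (\sum_(x' | cl p x' == t) \sum_(z | cl p z == s) M x' z).
  rewrite -(card_cl p p x) mulr_natl -sumr_const.
  apply: eq_big => [x'|x']; rewrite inE // => /eqP px'.
  rewrite -LE; move/adj_algP: (adj_algM algM (adj_alg_tr (adj_alg_adjm sS))) => clMs.
  by apply: clMs; apply: cl_tr.
rewrite exchange_big -(card_cl p q y) mulr_natl -sumr_const.
apply/esym; apply: eq_big => [z|z]; rewrite inE // => /eqP pz.
by rewrite -RE; move/adj_algP: (adj_algM (adj_alg_adjm tS) algM); apply.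
Qed.

(** The analogue of averaging over a group: up to the factor [n], the matrices [adjm s] and their
    transposes divided by the valencies are dual bases for the trace form. *)
Definition casimir (X : 'M_n) : 'M_n :=
  \sum_(s in S) (nv s)%:R^-1 *: ((adjm s)^T *m X *m adjm s).

Lemma casimir_comm X : commutant (casimir X).
Proof.
move=> M algM; apply/matrixP => x y; rewrite /casimir mulmx_sumr mulmx_suml !summxE.
transitivity (\sum_q \sum_p (nv (cl q y))%:R^-1 * (M *m (adjm (cl q y))^T) x p * X p q).
  transitivity (\sum_(s in S) \sum_q
      (nv s)%:R^-1 * ((M *m (adjm s)^T *m X) x q * (cl q y == s)%:R)).
    apply: eq_bigr => s sS; rewrite -scalemxAr mxE !mulmxA mxE mulr_sumr.
    by apply: eq_bigr => q _; rewrite adjmE.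
  rewrite exchange_big; apply: eq_bigr => q _.
  rewrite (bigD1 (cl q y)) ?color_in //= big1 => [|s /andP[_ /negPf]]; last first.
    by rewrite eq_sym => ->; rewrite !mulr0.
  rewrite eqxx addr0 mulr1 mxE mulr_sumr; apply: eq_bigr => p _; exact: mulrA.
transitivity (\sum_p \sum_q (nv (cl p x))%:R^-1 * (X p q * (adjm (cl p x) *m M) q y)).
  rewrite exchange_big; apply: eq_bigr => p _; apply: eq_bigr => q _.
  by rewrite adjm_mul_entries // -mulrA; congr (_ * _); apply: mulrC.
apply/esym; transitivity (\sum_(s in S) \sum_p
    (nv s)%:R^-1 * ((cl p x == s)%:R * (X *m (adjm s *m M)) p y)).
  apply: eq_bigr => s sS; rewrite -scalemxAl mxE -!mulmxA mxE mulr_sumr.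
  by apply: eq_bigr => p _; rewrite mxE adjmE.
rewrite exchange_big; apply: eq_bigr => p _.
rewrite (bigD1 (cl p x)) ?color_in //= big1 => [|s /andP[_ /negPf]]; last first.
  by rewrite eq_sym => ->; rewrite mul0r mulr0.
by rewrite eqxx addr0 mul1r mxE mulr_sumr.
Qed.

Lemma casimir_sub X (U : 'M_n) : cs_invariant S U -> (X <= U)%MS ->
  forall N : 'M_n, (N *m casimir X <= U)%MS.
Proof.
move=> invU XU N; rewrite /casimir mulmx_sumr; apply: summx_sub => s sS.
rewrite -scalemxAr scalemx_sub // mulmxA.
apply: submx_trans (invU _ (adj_alg_adjm sS)); apply: submxMr.
by rewrite mulmxA (submx_trans (submxMl _ _)).
Qed.

Let Z := casimir 1%:M.

Lemma casimir1_alg : in_adj_alg S Z.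
Proof.
apply: adj_alg_sum => s sS; rewrite mulmx1; apply: adj_algZ.
by apply: adj_algM; rewrite ?adj_alg_tr ?adj_alg_adjm.
Qed.

Lemma casimir1_entry x y : Z x y = \sum_z (nv (cl z x))%:R^-1 * (cl z x == cl z y)%:R.
Proof.
rewrite summxE; transitivity (\sum_(s in S) \sum_z
    (nv s)%:R^-1 * ((cl z x == s)%:R * (cl z y == s)%:R : algC)).
  apply: eq_bigr => s sS; rewrite mulmx1 2!mxE mulr_sumr.
  by apply: eq_bigr => z _; rewrite mxE !adjmE.
rewrite exchange_big; apply: eq_bigr => z _.
rewrite (bigD1 (cl z x)) ?color_in //= big1 => [|s /andP[_ /negPf]]; last first.
  by rewrite eq_sym => ->; rewrite mul0r mulr0.
by rewrite eqxx addr0 mul1r eq_sym.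
Qed.

Lemma nv_tr x y : nv (cl x y) = nv (cl y x).
Proof. by rewrite /nv !cl_diag eq_sym. Qed.

Lemma casimir1E : Z = \sum_(s in S) (nv s)%:R^-1 *: (adjm s *m (adjm s)^T).
Proof.
apply/matrixP => x y; rewrite casimir1_entry summxE.
transitivity (\sum_(s in S) \sum_z
    (nv s)%:R^-1 * ((cl x z == s)%:R * (cl y z == s)%:R : algC)); last first.
  apply: eq_bigr => s sS; rewrite 2!mxE mulr_sumr.
  by apply: eq_bigr => z _; rewrite [_^T _ _]mxE !adjmE.
rewrite exchange_big; apply: eq_bigr => z _.
rewrite (bigD1 (cl x z)) ?color_in //= big1 => [|s /andP[_ /negPf]]; last first.
  by rewrite eq_sym => ->; rewrite mul0r mulr0.
rewrite eqxx addr0 mul1r nv_tr; congr (_ * _%:R); congr nat_of_bool.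
by apply/eqP/eqP => [/cl_tr|/esym/cl_tr].
Qed.

(** [Z] is positive definite: the trace of [U Z U^*] is a sum of nonnegative terms, and the diagonal
    relation contributes the trace of [U U^*]. *)
Lemma casimir1_inj (U : 'M_n) : U *m Z = 0 -> U = 0.
Proof.
have [_ dS] := schS.
have ZE : Z = \sum_(s in S) (nv s)%:R^-1 *: ((adjm s)^T *m adjm s).
  by apply: eq_bigr => s _; rewrite mulmx1.
move=> UZ; have : \sum_(s in S) (nv s)%:R^-1 *
    \tr ((U *m (adjm s)^T) *m adjoint (U *m (adjm s)^T)) = 0.
  transitivity (\tr (U *m Z *m adjoint U)); last by rewrite UZ mul0mx mxtrace0.
  rewrite ZE mulmx_sumr mulmx_suml linear_sum /=; apply: eq_bigr => s sS.
  rewrite -scalemxAr -scalemxAl mxtraceZ adjointM !mulmxA; congr (_ * \tr (_ *m _ *m _)).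
  by apply/matrixP => i j; rewrite !mxE conjC_nat.
move/psumr_eq0P => /(_ _ (diag T) dS); rewrite adjm_diag trmx1 mulmx1 => U0.
have {}U0 : (nv (diag T))%:R^-1 * \tr (U *m adjoint U) = 0.
  by apply: U0 => s _; rewrite mulr_ge0 ?invr_ge0 ?ler0n ?mxtrace_adjoint_ge0.
apply: mxtrace_adjoint_eq0; apply/eqP; move/eqP: U0.
by rewrite mulf_eq0 invr_eq0 (negPf (nv_neq0 _)).
Qed.

(** * The central primitive idempotent of an irreducible submodule *)

Section PrimitiveIdempotent.

Variables (U : 'M[algC]_n) (lam : algC).
Hypotheses (irrU : irreducible U) (UZ : U *m Z = lam *: U).
(** The rows of [u] form a basis of [U], and [u *m M *m v] is the matrix of the action of [M] on [U]
    in that basis. *)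
Variables (d : nat) (u : 'M[algC]_(d, n)) (v : 'M[algC]_(n, d)).
Hypotheses (eq_uU : (u :=: U)%MS) (uv : u *m v = 1%:M).

Let uU : (u <= U)%MS. Proof. by rewrite eq_uU. Qed.

Let rankU : \rank U = d.
Proof. by rewrite -eq_uU; apply/eqP/row_freeP; exists v. Qed.

Let uvK m (X : 'M_(m, n)) : (X <= U)%MS -> X *m v *m u = X.
Proof. by rewrite -eq_uU => /submxP[D ->]; rewrite -(mulmxA D) uv mulmx1. Qed.

Let scalar_u M a : U *m M = a *: U -> u *m M = a *: u.
Proof.
by have /submxP[D ->] := uU; rewrite -mulmxA => ->; rewrite scalemxAr.
Qed.

Let d_neq0 : d%:R != 0 :> algC.
Proof. by have [U0 _ _ _] := irrU; rewrite -rankU pnatr_eq0 mxrank_eq0. Qed.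

Lemma lam_neq0 : lam != 0.
Proof.
have [U0 _ _ _] := irrU; apply: contraNneq U0 => lam0.
by apply/eqP/casimir1_inj; rewrite UZ lam0 scale0r.
Qed.

(* Schur orthogonality for the representation afforded by [U]. *)
Lemma casimir_scalar (D : 'M_d) :
  u *m casimir (v *m D *m u) = (lam * \tr D / d%:R) *: u.
Proof.
have [U0 invU _ _] := irrU.
have XU : (v *m D *m u <= U)%MS by rewrite (submx_trans (submxMl _ _)).
have [a UE] := irreducible_scalar irrU (casimir_comm _) (casimir_sub invU XU U).
have {}UE := scalar_u UE; rewrite UE; congr (_ *: _).
apply: (canRL (mulfK d_neq0)).
transitivity (\tr (u *m casimir (v *m D *m u) *m v)).
  by rewrite UE -scalemxAl uv mxtraceZ mxtrace1.
rewrite /casimir mulmx_sumr mulmx_suml linear_sum /=.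
(* The scalar is found from the trace on [U]. Cyclicity of the trace exchanges [adjm s] and its
   transpose, which is why [Z] is needed in the form [casimir1E]. *)
transitivity (\tr (D *m (u *m Z) *m v)); last first.
  by rewrite (scalar_u UZ) -scalemxAr -scalemxAl -mulmxA uv mulmx1 mxtraceZ.
rewrite casimir1E mulmx_sumr mulmx_sumr mulmx_suml linear_sum /=.
apply: eq_bigr => s sS; rewrite -!scalemxAr -!scalemxAl !mxtraceZ; congr (_ * _).
have DuA : D *m u *m adjm s *m v *m u = D *m u *m adjm s.
  rewrite uvK // -mulmxA (submx_trans (submxMl _ _)) //.
  by rewrite (submx_trans _ (invU _ (adj_alg_adjm sS))) ?submxMr.
transitivity (\tr ((u *m (adjm s)^T *m v) *m (D *m (u *m adjm s *m v)))).
  by rewrite !mulmxA.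
by rewrite mxtrace_mulC !mulmxA DuA.
Qed.

(** The character formula for the central idempotent; [d / lam] stands for the usual multiplicity
    divided by [n], to which it is equal by [isotypic_rank]. *)
Definition isotypic : 'M[algC]_n :=
  (d%:R / lam) *: \sum_(s in S) ((nv s)%:R^-1 * \tr (u *m (adjm s)^T *m v)) *: adjm s.

Lemma isotypic_alg : in_adj_alg S isotypic.
Proof.
by apply: adj_algZ; apply: adj_alg_sum => s sS; apply: adj_algZ; apply: adj_alg_adjm.
Qed.

Lemma isotypic_row (w : 'rV_n) :
  w *m isotypic = (d%:R / lam) *: \sum_p row p u *m casimir (col p v *m w).
Proof.
rewrite /isotypic -scalemxAr; congr (_ *: _).
under [RHS]eq_bigr do rewrite mulmx_sumr.
rewrite exchange_big mulmx_sumr; apply: eq_bigr => s sS.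
rewrite -scalemxAr -scalerA /mxtrace scaler_suml scaler_sumr.
apply: eq_bigr => p _; rewrite -scalemxAr; congr (_ *: _).
rewrite !mulmxA [X in X *m w]mx11_scalar mul_scalar_mx -scalemxAl; congr (_ *: _).
rewrite -!row_mul mxE [row _ _ _ _]mxE [RHS]mxE; apply: eq_bigr => i _.
by rewrite [col _ _ _ _]mxE.
Qed.

(** For [w] in [U], each term is [casimir_scalar] at a rank-one [D] whose trace is a coordinate of
    [w] in the basis [u]. *)
Lemma isotypic_id : U *m isotypic = U.
Proof.
suff rowE (w : 'rV_n) : (w <= U)%MS -> w *m isotypic = w.
  by apply/row_matrixP => i; rewrite row_mul rowE // row_sub.
move=> wU; rewrite isotypic_row -{2}(uvK wU) [in RHS]mulmx_sum_row scaler_sumr.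
apply: eq_bigr => p _.
have -> : col p v *m w = v *m (delta_mx p 0 *m (w *m v)) *m u.
  by rewrite colE !mulmxA -[X in _ = X]mulmxA -[X in _ = X]mulmxA (mulmxA w) uvK.
rewrite -row_mul casimir_scalar linearZ scalerA /=; congr (_ *: _).
rewrite mxtrace_mulC trace_mx11 -colE mxE.
have := lam_neq0; move: d_neq0 => d0 l0; field; exact/andP.
Qed.

(** The second alternative makes [W] a homomorphic image of [U]. The averaged operators in
    [isotypic_row] are homomorphisms from [U] to [W]; a nonzero one is onto by irreducibility of
    [W]. *)
Lemma isotypic_cases W : irreducible W ->
  W *m isotypic = 0 \/ exists2 F, commutant F & (W <= U *m F)%MS.
Proof.
move=> [W0 invW _ minW]; have [_ invU _ _] := irrU.
have [exF | noF] := classic (exists2 F, commutant F & (W <= U *m F)%MS); first by right.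
left; suff rowE (w : 'rV_n) : (w <= W)%MS -> w *m isotypic = 0.
  by apply/row_matrixP => i; rewrite row_mul rowE ?row0 // row_sub.
move=> wW; rewrite isotypic_row big1 ?scaler0 // => p _.
set F := casimir _.
have UF : U *m F = 0.
  apply/eqP/negPn/negP => UF0; apply: noF; exists F; first exact: casimir_comm.
  apply: minW => // [|M algM].
    by apply: casimir_sub => //; rewrite (submx_trans (submxMl _ _)).
  by rewrite -mulmxA -casimir_comm // mulmxA submxMr ?invU.
by have /submxP[D ->] : (row p u <= U)%MS by [rewrite (submx_trans (row_sub _ _))];
  rewrite -mulmxA UF mulmx0.
Qed.

(** A central element acts by the same scalar on [U] and on all its homomorphic images. *)
Lemma irreducible_comm_scalar M : in_adj_alg S M -> commutant M ->
  exists a, forall W, irreducible W ->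
    (W *m isotypic = 0) \/ (W *m isotypic = W /\ W *m M = a *: W).
Proof.
move=> algM comM; have [_ invU _ _] := irrU.
have [a UM] := irreducible_scalar irrU comM (invU _ algM).
exists a => W irrW; have [|[F comF /submxP[D ->]]] := isotypic_cases irrW; first by left.
right; rewrite -!mulmxA -(comF _ isotypic_alg) -(comF _ algM) !mulmxA.
by rewrite -(mulmxA D U M) UM -(mulmxA D U isotypic) isotypic_id -scalemxAr -scalemxAl.
Qed.

Lemma isotypic_scalar W : irreducible W -> W *m isotypic = 0 \/ W *m isotypic = W.
Proof.
move=> irrW; have algI : in_adj_alg S 1%:M by rewrite -adjm_diag; case: schS => _ /adj_alg_adjm.
have [|a /(_ W irrW)] := irreducible_comm_scalar algI; last by case=> [|[]]; auto.
by move=> M _; rewrite mul1mx mulmx1.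
Qed.

Lemma isotypic_comm : commutant isotypic.
Proof.
move=> M algM; apply/eqP; rewrite -subr_eq0; apply/eqP/irreducible_ext => W irrW.
have [_ invW _ _] := irrW; have /submxP[D WM] := invW _ algM.
rewrite mulmxBr !mulmxA WM -(mulmxA D W).
by case: (isotypic_scalar irrW) => ->; rewrite ?mulmx0 ?mul0mx ?WM subrr.
Qed.

Lemma isotypic_idem : isotypic *m isotypic = isotypic.
Proof.
apply/eqP; rewrite -subr_eq0; apply/eqP/irreducible_ext => W irrW.
by rewrite mulmxBr mulmxA; case: (isotypic_scalar irrW) => WP; rewrite !WP ?mul0mx subrr.
Qed.

Lemma isotypic_neq0 : isotypic != 0.
Proof.
have [U0 _ _ _] := irrU; apply: contraNneq U0 => P0.
by rewrite -isotypic_id P0 mulmx0.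
Qed.

Lemma isotypic_primitive : central_primitive_idempotent S isotypic.
Proof.
split; [split | exact: isotypic_neq0 | ].
- exact: isotypic_alg.
- exact: isotypic_idem.
- by move=> M /isotypic_comm.
move=> E [algE EE comE] EP.
have comE' : commutant E by move=> N algN; rewrite comE.
have [a aP] := irreducible_comm_scalar algE comE'.
(* [E] acts as one scalar [a] on the isotypic component and as 0 elsewhere; idempotency then leaves
   only [a = 0] or [a = 1]. *)
have Ea : E = a *: isotypic.
  apply/eqP; rewrite -subr_eq0; apply/eqP/irreducible_ext => W irrW.
  rewrite mulmxBr -scalemxAr; case: (aP W irrW) => [WP | [WP WE]].
    by rewrite -EP comE ?isotypic_alg // mulmxA WP mul0mx scaler0 subrr.
  by rewrite WP WE subrr.
have : (a * a - a) *: isotypic = 0.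
  move: EE; rewrite Ea -scalemxAl -scalemxAr isotypic_idem scalerA scalerBl => ->.
  by rewrite subrr.
move/eqP; rewrite scaler_eq0 (negPf isotypic_neq0) orbF -{3}[a]mulr1 -mulrBr mulf_eq0.
by rewrite subr_eq0 => /orP[] /eqP a_val; rewrite Ea a_val ?scale0r ?scale1r; auto.
Qed.

(** The rank of an idempotent is its trace, and only the diagonal relation contributes to it. *)
Lemma isotypic_rank : (\rank isotypic)%:R * lam = (d ^ 2 * n)%:R.
Proof.
have [_ dS] := schS.
rewrite -(mxtrace_idempotent isotypic_idem) mxtraceZ linear_sum (bigD1 (diag T)) //=.
rewrite big1 => [|s /andP[sS sD]]; last first.
  rewrite mxtraceZ; suff -> : \tr (adjm s) = 0 by rewrite mulr0.
  apply: big1 => i _; rewrite adjmE //.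
  by have /eqP -> : cl i i == diag T; rewrite ?cl_diag // eq_sym (negPf sD).
rewrite adjm_diag trmx1 mulmx1 uv mxtraceZ !mxtrace1 addr0 /nv eqxx.
rewrite natrM natrX; have := lam_neq0 => l0; by field.
Qed.

End PrimitiveIdempotent.

(** * Consequences of the pseudocyclic condition *)

Hypotheses (pcS : pseudocyclic S) (n_gt1 : (1 < n)%N).

Let J : 'M[algC]_n := const_mx 1.

Let n_neq0 : n%:R != 0 :> algC. Proof. by rewrite pnatr_eq0 -lt0n ltnW. Qed.

(** By [isotypic_rank] the eigenvalue of [Z] on [U] is [n] divided by [rk P / d^2], which is the
    constant [c]; the condition [U *m J = 0] excludes the trivial idempotent. *)
Lemma pseudocyclic_casimir : exists mu, forall U, irreducible U -> U *m J = 0 -> U *m Z = mu *: U.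
Proof.
have [c pcP] := pcS; exists (n%:R / c) => U irrU UJ.
have [U0 invU _ minU] := irrU.
have [lam UZ] := irreducible_scalar irrU (casimir_comm _) (invU _ casimir1_alg).
pose u := row_base U; have uv : u *m pinvmx u = 1%:M by exact: mulmxVp (row_base_free U).
have uU : (u :=: U)%MS by exact: eq_row_base.
have primP := isotypic_primitive irrU UZ uU uv.
have UP := isotypic_id irrU UZ uU uv.
have rkP := isotypic_rank irrU UZ uU uv.
move: primP UP rkP; set P := isotypic _ _ _ => primP UP rkP.
have PJ : P != Jn T.
  apply: contraNneq U0 => PJ; apply/eqP.
  by rewrite -UP PJ /Jn -scalemxAr UJ scaler0.
have irrP : irreducible_submodule_of S P U by split; rewrite // -UP submxMl.
have d0 : (\rank U)%:R != 0 :> algC by rewrite pnatr_eq0 mxrank_eq0.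
rewrite UZ; congr (_ *: _).
have lamc : lam * c = n%:R.
  rewrite -(pcP P primP PJ U irrP); move: rkP; rewrite natrM natrX => rkP.
  apply: (mulfI d0); apply: (mulfI d0); rewrite !mulrA -expr2 -rkP.
  by field.
have c0 : c != 0 by apply: contraNneq n_neq0 => c0; rewrite -lamc c0 mulr0.
by rewrite -lamc mulfK.
Qed.

(** The product has equal rows and is constant on the diagonal, so all its entries agree. *)
Lemma mul_const_alg M : in_adj_alg S M -> exists a, J *m M = a *: J.
Proof.
move=> algM; exists ((J *m M) (Ordinal (ltnW n_gt1)) (Ordinal (ltnW n_gt1))).
have /adj_algP clJM := adj_algM (adj_alg_const 1) algM.
have JM i j i' : (J *m M) i j = (J *m M) i' j.
  by rewrite !mxE; apply: eq_bigr => z _; rewrite !mxE.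
apply/matrixP => i j; rewrite [RHS]mxE [J _ _]mxE mulr1 (JM _ _ j); apply: clJM.
by rewrite /cl !color_refl.
Qed.

Lemma mul_const_casimir : J *m Z = n%:R *: J.
Proof.
apply/matrixP => i y; rewrite !mxE mulr1.
transitivity (\sum_z \sum_x (nv (cl z x))%:R^-1 * (cl z x == cl z y)%:R : algC).
  rewrite exchange_big; apply: eq_bigr => x _; rewrite mxE mul1r; exact: casimir1_entry.
rewrite -[n in RHS]card_ord -sumr_const; apply: eq_bigr => z _.
transitivity (\sum_(x in [set x | cl z x == cl z y]) (nv (cl z y))%:R^-1 : algC).
  rewrite [RHS]big_mkcond; apply: eq_bigr => x _; rewrite inE.
  by case: eqP => [->|_]; rewrite ?mulr1 ?mulr0.
by rewrite sumr_const card_cl -[_ *+ _]mulr_natr mulVf // nv_neq0.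
Qed.

Lemma pseudocyclic_casimirE : exists mu nu, Z = mu%:M + nu *: J /\ nu * n%:R = n%:R - mu.
Proof.
have [mu muP] := pseudocyclic_casimir; exists mu, ((n%:R - mu) / n%:R).
split; last by rewrite mulfVK.
set nu := _ / _.
apply/eqP; rewrite -subr_eq0; apply/eqP/irreducible_ext => W irrW.
have [W0 invW _ minW] := irrW.
have [WJ | WJ] := eqVneq (W *m J) 0.
  by rewrite mulmxBr mulmxDr muP // mul_mx_scalar -scalemxAr WJ scaler0 addr0 subrr.
(* A submodule not killed by [J] contains the all-ones row, hence equals its span by minimality;
   there [nu] is fixed by [mul_const_casimir]. *)
have JW : (J <= W)%MS.
  have /matrix0Pn[i [j WJij]] := WJ.
  apply: submx_trans (invW _ (adj_alg_const 1)).
  apply/row_subP => l; rewrite -[row l J](scalerK WJij) scalemx_sub //.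
  have -> : (W *m J) i j *: row l J = row i (W *m J).
    by apply/rowP => m; rewrite !mxE mulr1; apply: eq_bigr => z _; rewrite !mxE.
  exact: row_sub.
have J0 : J != 0.
  apply/eqP => /matrixP/(_ (Ordinal (ltnW n_gt1)) (Ordinal (ltnW n_gt1))).
  by move/eqP; rewrite !mxE oner_eq0.
have /submxP[D ->] : (W <= J)%MS.
  apply: minW => // M algM; have [a ->] := mul_const_alg algM; exact: scalemx_sub.
have JJ : J *m J = n%:R *: J.
  apply/matrixP => i j; rewrite !mxE mulr1 -[n in RHS]card_ord -sumr_const.
  by apply: eq_bigr => z _; rewrite !mxE mulr1.
rewrite -mulmxA (_ : J *m _ = 0) ?mulmx0 // mulmxBr mulmxDr mul_const_casimir.
rewrite mul_mx_scalar -scalemxAr JJ scalerA mulfVK //.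
by rewrite -scalerDl -scalerBl [mu + _]addrC subrK subrr scale0r.
Qed.

(** With [N] the count, [Z] has diagonal entry [mu + nu = 1 + (n - 1) / k] and off-diagonal entry
    [nu = N / k]. Together with [nu * n = n - mu] this gives [(n - 1) * (N - (k - 1)) = 0]. *)
Lemma pseudocyclic_indistinguishing x y : x != y ->
  #|[set z | color S z x == color S z y]| = k.-1.
Proof.
move=> xy; have [mu [nu [ZE nuE]]] := pseudocyclic_casimirE.
pose i := enum_rank x; pose j := enum_rank y.
have ij : i != j by rewrite (inj_eq enum_rank_inj).
have <- : #|[set z | cl z i == cl z j]| = #|[set z | color S z x == color S z y]|.
  by apply: card_enum_val => z; rewrite !inE /cl !enum_rankK.
have k0 : k%:R != 0 :> algC by rewrite pnatr_eq0 -lt0n.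
have nvE z l : z != l -> nv (cl z l) = k by rewrite /nv cl_diag => /negPf->.
have nv1 : nv (cl i i) = 1%N by rewrite /nv cl_diag eqxx.
have diagE : mu + nu = 1 + n.-1%:R / k%:R.
  transitivity (Z i i); first by rewrite ZE !mxE eqxx mulr1.
  rewrite casimir1_entry (bigD1 i) //= nv1 eqxx invr1 mulr1; congr (_ + _).
  transitivity (\sum_(z in predC1 i) (k%:R^-1 : algC)).
    by apply: eq_bigr => z zi; rewrite nvE // eqxx mulr1.
  by rewrite sumr_const cardC1 card_ord mulr_natl.
have offE : nu = #|[set z | cl z i == cl z j]|%:R / k%:R.
  transitivity (Z i j).
    by rewrite ZE !mxE (negPf ij) add0r mulr1.
  rewrite casimir1_entry.
  transitivity (\sum_(z in [set z | cl z i == cl z j]) (k%:R^-1 : algC)); last first.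
    by rewrite sumr_const mulr_natl.
  rewrite [RHS]big_mkcond; apply: eq_bigr => z _; rewrite inE.
  case: eqP => [zij|_]; last by rewrite mulr0.
  (* The point [z = i] is not counted: it would make [cl i j] diagonal. So every term has weight
     [1 / k]. *)
  rewrite mulr1 nvE //; apply: contraNneq ij => zi.
  by have := cl_diag z j; rewrite -zij zi cl_diag eqxx => /esym.
apply/eqP; rewrite -(eqr_nat algC) -subn1 natrB // -subr_eq0; apply/eqP.
have n1 : n%:R = n.-1%:R + 1 :> algC by rewrite natr1 prednK // ltnW.
have n1_neq0 : n.-1%:R != 0 :> algC by rewrite pnatr_eq0; move: n_gt1; lia.
apply: (mulfI n1_neq0); rewrite mulr0.
have -> : #|[set z | cl z i == cl z j]|%:R = nu * k%:R by rewrite offE mulfVK.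
have muE : mu = 1 + n.-1%:R / k%:R - nu by rewrite -diagE addrK.
move: nuE; rewrite muE n1 => /(congr1 (fun a => a * k%:R)) nuE.
have -> : n.-1%:R * (nu * k%:R - (k%:R - 1)) =
   nu * (n.-1%:R + 1) * k%:R - (n.-1%:R + 1 - (1 + n.-1%:R / k%:R - nu)) * k%:R.
  by field.
by rewrite nuE subrr.
Qed.

End AdjacencyAlgebra.

Theorem theorem6p4 (T : finType) (S : {set {set T * T}}) (k : nat) :
  scheme S -> pseudocyclic S -> has_valency S k -> (1 < k)%N ->
  (4 * (k - 1) * k ^ 3 <= #|S|)%N ->
  frobenius_scheme S /\ separable S.
Proof.
move=> schS pcS valS k_gt1 large; have k_gt0 := ltnW k_gt1.
have /card_gt0P[a _] := scheme_card_gt0 schS k_gt1 large.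
have T_gt1 : 1 < #|T|.
  apply: leq_trans (large_points schS valS k_gt1 large a).
  have : 0 < k * (k * k.-1) by rewrite !muln_gt0; lia.
  lia.
have indist x y : x != y -> #|[set z | color S z x == color S z y]| <= k.-1.
  by move=> xy; rewrite (pseudocyclic_indistinguishing schS valS k_gt0 pcS T_gt1 xy).
by split; [exact: scheme_frobenius indist large | exact: scheme_separable indist large].
Qed.
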